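(* Let $n\geq 2$, $1\leq k\leq n-1$, and $q=p^h$ with $p>5$ prime and $h\geq 1$. There is no codeword $c\in \mathrm{C}_k(n,q)\setminus \mathrm{C}_{n-k}(n,q)^\perp$ whose weight lies in the open interval $]\theta_k, 2q^k[$.
   Context: $\mathrm{PG}(n,q)$ is the $n$-dimensional projective space over $\mathbb{F}_q$, $q=p^h$; $\theta_m=(q^{m+1}-1)/(q-1)$ is the number of points of $\mathrm{PG}(m,q)$. For $1\le j\le n-1$, $\mathrm{C}_j(n,q)$ is the $p$-ary linear code (a subspace of $\mathbb{F}_p^{\theta_n}$, coordinates indexed by the points of $\mathrm{PG}(n,q)$) spanned over $\mathbb{F}_p$ by the incidence vectors of the $j$-dimensional subspaces of $\mathrm{PG}(n,q)$. $(\cdot,\cdot)$ is the standard scalar product over $\mathbb{F}_p$ and $\mathrm{C}_j(n,q)^\perp=\{v : (v,c)=0\ \forall c\in\mathrm{C}_j(n,q)\}$, equivalently the set of $v$ with $(v,J)=0$ for the incidence vector $J$ of every $j$-space. The weight of a vector is its number of nonzero coordinates. *)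

(* Defs.v *)
From HB Require Import structures.
From mathcomp Require Import all_boot all_order all_algebra.
Set Implicit Arguments. Unset Strict Implicit. Unset Printing Implicit Defensive.
Import GRing.Theory.
Local Open Scope ring_scope.

(* PG(n,q) is modelled as the lattice of subspaces of F^(n+1) = 'rV[F]_(n.+1),
   F a finite field.  A vector subspace is represented canonically by its
   square matrix A with <<A>> = A (mxalgebra's canonical row-space form).
   A projective j-space is a vector subspace of rank j+1. *)

Definition proj_subspaces (F : finFieldType) (m j : nat) : {set 'M[F]_m} :=
  [set A : 'M[F]_m | (<<A>>%MS == A) && (\rank A == j.+1)%N].

Definition point (F : finFieldType) (n : nat) :=
  {A : 'M[F]_(n.+1) | A \in proj_subspaces F n.+1 0}.

Definition word (F : finFieldType) (n p : nat) := {ffun point F n -> 'F_p}.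

Definition incid (F : finFieldType) (n p : nat) (S : 'M[F]_(n.+1)) : word F n p :=
  [ffun x : point F n => ((val x <= S)%MS)%:R].

Definition in_code (F : finFieldType) (n p j : nat) (c : word F n p) : Prop :=
  exists a : 'M[F]_(n.+1) -> 'F_p,
    forall x : point F n,
      c x = \sum_(S in proj_subspaces F n.+1 j) a S * incid p S x.

Definition dotp (F : finFieldType) (n p : nat) (v w : word F n p) : 'F_p :=
  \sum_(x : point F n) v x * w x.

Definition in_dual_code (F : finFieldType) (n p j : nat) (v : word F n p) : Prop :=
  forall c : word F n p, in_code j c -> dotp v c = 0.

Definition wt (F : finFieldType) (n p : nat) (c : word F n p) : nat :=
  #|[set x | c x != 0]|.

Definition theta (q m : nat) : nat := ((q ^ m.+1 - 1) %/ (q - 1))%N.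

(* Main.v *)
(* A codeword c = sum_K a_K [K] is lifted to the function f v = sum_K a_K [v in K]
   on V = F^(n+1); let T be its support and q = #|F|, so #|T| = 1 + wt(c) (q - 1).
   The sum of f vanishes over every subspace of V meeting all the K nontrivially,
   and f 0 != 0 because c is not in the dual code.

   First, f is constant on T.  If Q in T lies on no tangent subspace of dimension
   n - k + 1, then #|T| being small gives such a subspace whose only points of T
   are Q and one other point R, so that f Q + f R = f 0; Jamison's bound on affine
   blocking sets, in a plane through that pair, then yields a tangent at Q or R,
   forcing f Q = f 0 or f Q = 0.

   Now view V as a vector space over the prime field: p divides the size of the
   intersection of T with every sufficiently large F_p-subspace.  Since T is
   closed under F_p-scaling, these sizes are p or at least p^2, and a second
   moment count over hyperplanes shows that a large F_p-subspace meets T in at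
   most p^2 or at least p^3 - p^2 + 1 vectors.  Any x, y in T lie in one meeting T
   in at most 3 p^2 vectors, where the section must be the span of x and y.  So T
   is a subspace, and its size is a power of q. *)
Require Import Defs.
From HB Require Import structures.
From mathcomp Require Import all_boot all_order all_algebra.
From mathcomp Require Import finfield mxabelem.
From mathcomp Require Import zify ring.
Import GRing.Theory Num.Theory.
Local Open Scope ring_scope.

Set Implicit Arguments.
Unset Strict Implicit.
Unset Printing Implicit Defensive.

(** * Row spaces, orthogonality and ranks *)

Lemma scaler_add_closed_rowg (F : finFieldType) (n : nat) (Z : {set 'rV[F]_n}) :
  0 \in Z -> (forall a v, v \in Z -> a *: v \in Z) ->
  {in Z &, forall u v, u + v \in Z} ->
  exists A : 'M[F]_n, Z = rowg A.
Proof.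
move=> Z0 ZZ ZD; exists (\sum_(v in Z) <<v>>)%MS.
apply/setP=> v; rewrite mem_rowg; apply/idP/idP => [vZ|].
  by rewrite (sumsmx_sup v) // genmxE.
case/sub_sumsmxP=> u ->; apply: (big_ind (fun x => x \in Z)) => // w wZ.
have /sub_rVP[a ->] : (u w *m <<w>>%MS <= w)%MS by rewrite -(genmxE w) submxMl.
exact: ZZ.
Qed.

Lemma card_orthogonal (F : finFieldType) (m n : nat) (A : 'M[F]_(m, n)) :
  #|[set l : 'rV[F]_n | A *m l^T == 0]| = (#|F| ^ (n - \rank A))%N.
Proof.
rewrite -(mxrank_tr A) -mxrank_ker -card_rowg; apply: eq_card => l.
by rewrite mem_rowg inE sub_kermx -trmx_eq0 trmx_mul trmxK.
Qed.

Lemma mul_col_mx_eq0 (F : finFieldType) (m1 m2 n p : nat)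
    (A : 'M[F]_(m1, n)) (B : 'M[F]_(m2, n)) (C : 'M[F]_(n, p)) :
  (col_mx A B *m C == 0) = (A *m C == 0) && (B *m C == 0).
Proof. by rewrite mul_col_mx col_mx_eq0. Qed.

Lemma rank_col_mx_rV (F : fieldType) (m n : nat) (A : 'M[F]_(m, n)) (v : 'rV[F]_n) :
  \rank (col_mx A v) = (\rank A + ~~ (v <= A)%MS)%N.
Proof.
rewrite -addsmxE; case: (boolP (v <= A)%MS) => vA /=.
  by rewrite addn0; apply/eqmx_rank/eqmxP/addsmx_idPl.
have v0 : v != 0 by apply: contraNneq vA => ->; apply: sub0mx.
have := mxrank_sum_cap A v; rewrite rank_rV v0.
suff -> : \rank (A :&: v)%MS = 0%N by rewrite addn0.
apply/eqP; apply: contraNT vA; rewrite -lt0n => r0.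
apply: submx_trans (capmxSl A v).
have := mxrank_leqif_sup (capmxSr A v).
by rewrite rank_rV v0 => /geq_leqif <-.
Qed.

(** * The first two moments of the sizes of hyperplane sections *)

Section HyperplaneSections.

Variables (F : finFieldType) (n : nat) (X : {set 'rV[F]_n.+2}).
Hypotheses (X0 : 0 \in X) (XZ : forall a v, v \in X -> a *: v \in X).
Let q := #|F|.
Let N (l : 'rV[F]_n.+2) := #|[set v in X | v *m l^T == 0]|.

Let card_X_line v : v \in X -> v != 0 -> #|[set w in X | (w <= v)%MS]| = q.
Proof.
move=> vX v0; have -> : [set w in X | (w <= v)%MS] = rowg v.
  apply/setP=> w; rewrite mem_rowg inE andb_idl // => /sub_rVP[a ->]; exact: XZ.
by rewrite card_rowg rank_rV v0 expn1.
Qed.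

(** Double count of the pairs (l, v) with l killing v; v imposes one condition on l, or none if v =
    0. The ambient dimension [n.+2] keeps such exponents untruncated for two vectors as well. *)
Let sum_N : (\sum_l N l = \sum_(v in X) q ^ (n.+2 - (v != 0%R)))%N.
Proof.
rewrite /N; under eq_bigr => l _ do rewrite -sum1_card.
under eq_bigr => l _ do under eq_bigl => v do rewrite inE.
rewrite (exchange_big_dep (mem X)) /= => [|l v _ /andP[]//].
apply: eq_bigr => v vX; rewrite sum1dep_card -rank_rV -card_orthogonal.
by apply: eq_card => l; rewrite !inE vX.
Qed.

Lemma sum_card_orthogonal_hyperplane :
  (\sum_l N l = q ^ n * (q ^ 2 + (#|X| - 1) * q))%N.
Proof.
rewrite sum_N.
rewrite (bigD1 0) //= eqxx subn0.
rewrite (eq_bigr (fun=> q ^ n.+1)%N); last by move=> v /andP[_ ->].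
rewrite sum_nat_const mulnDr -expnD addn2; congr (_ + _)%N.
rewrite mulnCA -expnSr; congr (_ * _)%N.
by rewrite (cardD1 0 X) X0 addKn; apply: eq_card => v; rewrite !inE andbC.
Qed.

(** Counts triples (l, v, w). The terms with v = 0 give back the first moment; for v nonzero, the
    [q] multiples of v impose no new condition on l, the other [#|X| - q] vectors impose one
    more. *)
Lemma sum_card_orthogonal_hyperplane_sqr :
  (\sum_l N l ^ 2 = q ^ n * (q ^ 2 + (#|X| - 1) * q)
     + (#|X| - 1) * (q ^ n * (q ^ 2 + (#|X| - q))))%N.
Proof.
transitivity (\sum_(v in X) \sum_(w in X) #|F| ^ (n.+2 - \rank (col_mx v w)))%N.
  have E l : (N l ^ 2 = \sum_(v in X | v *m l^T == 0%R) \sum_(w in X | w *m l^T == 0%R) 1)%N.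
    by rewrite !sum_nat_const muln1 -mulnn /N; congr (_ * _)%N; apply: eq_card => v; rewrite !inE.
  under eq_bigr => l _ do rewrite E.
  rewrite (exchange_big_dep (mem X)) /= => [|l v _ /andP[]//].
  apply: eq_bigr => v vX.
  rewrite (exchange_big_dep (mem X)) /= => [|l w _ /andP[]//].
  apply: eq_bigr => w wX.
  rewrite sum1dep_card -card_orthogonal; apply: eq_card => l.
  by rewrite !inE mul_col_mx_eq0 vX wX.
rewrite (bigD1 0) //=; congr (_ + _)%N.
  rewrite -sum_card_orthogonal_hyperplane sum_N; apply: eq_bigr => v vX.
  have v0E : (v <= (0 : 'rV[F]_n.+2))%MS = (v == 0).
    by apply/idP/eqP => [/submx0null//|->]; apply: sub0mx.
  by rewrite rank_col_mx_rV mxrank0 v0E.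
rewrite (eq_bigr (fun=> q ^ n * (q ^ 2 + (#|X| - q)))%N) => [|v /andP[vX v0]].
  rewrite sum_nat_const; congr (_ * _)%N.
  by rewrite (cardD1 0 X) X0 addKn; apply: eq_card => v; rewrite !inE andbC.
rewrite (bigID (fun w => (w <= v)%MS)) /= mulnDr; congr (_ + _)%N.
  rewrite (eq_bigr (fun=> q ^ n.+1)%N) => [|w /andP[_ wv]].
    rewrite sum_nat_const (_ : #|_| = q) -?expnS -?expnD ?addn2 //.
    by rewrite -(card_X_line vX v0); apply: eq_card => w; rewrite !inE.
  by rewrite rank_col_mx_rV rank_rV v0 wv.
rewrite (eq_bigr (fun=> q ^ n)%N) => [|w /andP[_ wv]].
  rewrite sum_nat_const mulnC; congr (_ * _)%N.
  rewrite -(card_X_line vX v0) -(cardsID [set w | (w <= v)%MS] X).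
  have -> : X :&: [set w | (w <= v)%MS] = [set w in X | (w <= v)%MS].
    by apply/setP=> w; rewrite !inE.
  by rewrite addKn; apply: eq_card => w; rewrite !inE andbC.
by rewrite rank_col_mx_rV rank_rV v0 wv subSS subn1.
Qed.

(* With [t = #|X|], the two moments give
   [sum_l (N l - q) (N l - q^2) = q^n (t - q^2) (t - (q^3 - q^2 + 1))]. *)
Lemma hyperplane_gap :
  (forall l, N l = q \/ (q ^ 2 <= N l)%N) ->
  (#|X| <= q ^ 2)%N \/ (q ^ 3 - q ^ 2 + 1 <= #|X|)%N.
Proof.
move=> gap; have q1 : (1 < q)%N := finNzRing_gt1 F.
have t1 : (0 < #|X|)%N by apply/card_gt0P; exists 0.
(* In the remaining case the difference [#|X| - q] of the second moment is not truncated. *)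
case: (leqP #|X| q) => [tq|qt].
  by left; apply: leq_trans tq _; rewrite -mulnn leq_pmulr // ltnW.
have : 0 <= \sum_l ((N l)%:Z - q%:Z) * ((N l)%:Z - q%:Z ^+ 2).
  apply: sumr_ge0 => l _; case: (gap l) => [->|]; first by rewrite subrr mul0r.
  by rewrite -mulnn expr2 => h; apply: mulr_ge0; nia.
have -> : \sum_l ((N l)%:Z - q%:Z) * ((N l)%:Z - q%:Z ^+ 2) =
   (\sum_l N l ^ 2)%N%:Z - (q%:Z + q%:Z ^+ 2) * (\sum_l N l)%N%:Z + q%:Z ^+ 3 * (q ^ n.+2)%N%:Z.
  have -> : (q ^ n.+2)%N = (\sum_(l : 'rV[F]_n.+2) 1)%N.
    by rewrite sum1_card card_mx mul1n.
  rewrite !(big_morph Posz PoszD (erefl (Posz 0))) !mulr_sumr -sumrB -big_split /=.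
  by apply: eq_bigr => l _; rewrite -mulnn PoszM; ring.
rewrite sum_card_orthogonal_hyperplane sum_card_orthogonal_hyperplane_sqr.
rewrite (_ : q ^ n.+2 = q ^ n * (q * q))%N; last by rewrite !expnSr mulnA.
set Q := (q ^ n)%N.
have Q0 : (0 < Q)%N by rewrite expn_gt0 ltnW.
move: qt t1; move: #|X| => t qt t1.
set e := (X in 0 <= X).
have -> : e = Q%:Z * ((t%:Z - q%:Z ^+ 2) * (t%:Z - (q%:Z ^+ 3 - q%:Z ^+ 2 + 1))).
  have [u tu] : exists u, t = (u + q)%N by exists (t - q)%N; lia.
  have [r qr] : exists r, q = r.+1 by exists q.-1; lia.
  rewrite /e tu addnK; have -> : (u + q - 1)%N = (u + r)%N by lia.
  by rewrite qr -!mulnn; ring.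
move=> H; have {}H : 0 <= (t%:Z - q%:Z ^+ 2) * (t%:Z - (q%:Z ^+ 3 - q%:Z ^+ 2 + 1)).
  by nia.
case: (leqP t (q ^ 2)%N) => [|lt]; [by left|right].
have : 0 <= (t%:Z - (q%:Z ^+ 3 - q%:Z ^+ 2 + 1)).
  by move: lt H; rewrite -mulnn; nia.
by rewrite !expnS expn0 !exprS expr0; nia.
Qed.

End HyperplaneSections.

(** * Sets closed under scaling and their sections by subspaces *)

Lemma eq_genmx_rV (F : fieldType) (n : nat) (u v : 'rV[F]_n) :
  u != 0 -> (<<u>>%MS == <<v>>%MS) = (u <= v)%MS.
Proof.
move=> u0; apply/eqP/idP => [uv|]; first by rewrite -(genmxE v) -uv genmxE.
case/sub_rVP=> a uav; apply/eq_genmx; rewrite uav; apply: eqmx_scale.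
by apply: contraNneq u0 => a0; rewrite uav a0 scale0r.
Qed.

Lemma card_scaler_closed (F : finFieldType) (n : nat) (X : {set 'rV[F]_n}) :
  0 \in X -> (forall a v, v \in X -> a *: v \in X) ->
  #|X| = (#|[set <<v>>%MS | v in X :\ 0]| * (#|F| - 1)).+1.
Proof.
move=> X0 XZ; rewrite (cardsD1 0) X0 add1n; congr _.+1.
rewrite -sum1_card (partition_big_imset (fun v => <<v>>%MS)) /=.
rewrite -sum_nat_const; apply: eq_bigr => _ /imsetP[u uX ->].
move: uX; rewrite !inE => /andP[u0 uX]; rewrite sum1dep_card.
have -> : (#|F| - 1)%N = #|rowg u :\ 0|.
  have := cardsD1 0 (rowg u).
  by rewrite mem_rowg sub0mx card_rowg rank_rV u0 expn1 => ->; rewrite addKn.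
apply: eq_card => v; rewrite !inE -andbA; case: eqVneq => //= v0.
rewrite eq_genmx_rV // andb_idl // => /sub_rVP[a ->]; exact: XZ.
Qed.

(** Counting by lines, [#|X|] is 1 modulo [#|F| - 1]. If it equals m times [#|F|], then m is also 1
    modulo [#|F| - 1], hence m is 1 or at least [#|F|]. *)
Lemma dvdn_card_scaler_closed (F : finFieldType) (n : nat) (X : {set 'rV[F]_n}) :
  0 \in X -> (forall a v, v \in X -> a *: v \in X) -> (#|F| %| #|X|)%N ->
  #|X| = #|F| \/ (#|F| ^ 2 <= #|X|)%N.
Proof.
move=> X0 XZ; rewrite (card_scaler_closed X0 XZ); move: #|[set _ | _ in _]| => s.
have := finNzRing_gt1 F; case: #|F| => // r r0 /dvdnP[m].
rewrite subn1 /= -mulnn => E; have [t Et] : exists t, m = (t * r).+1.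
  exists (s - m)%N; nia.
case: t Et => [|t] Et; [left|right]; nia.
Qed.

(** Average over the forms vanishing on A: a vector outside A is killed by exactly one in [#|F|] of
    them. *)
Lemma exists_hyperplane_cut (F : finFieldType) (m n : nat) (A : 'M[F]_(m, n))
    (Y : {set 'rV[F]_n}) :
  (forall v, v \in Y -> ~~ (v <= A)%MS) ->
  exists2 l : 'rV[F]_n, A *m l^T = 0 &
    (#|F| * #|[set v in Y | v *m l^T == 0%R]| <= #|Y|)%N.
Proof.
move=> YA; set O := [set l : 'rV[F]_n | A *m l^T == 0%R].
case: (pickP [pred l in O | #|F| * #|[set v in Y | v *m l^T == 0%R]| <= #|Y|]%N) => [l|none].
  by rewrite !inE => /andP[/eqP Al lY]; exists l.
have O0 : (0 < #|O|)%N.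
  by apply/card_gt0P; exists 0; rewrite inE trmx0 mulmx0.
have Ylt l : l \in O -> (#|Y| < #|F| * #|[set v in Y | v *m l^T == 0%R]|)%N.
  by move=> lO; have := none l; rewrite /= lO /= ltnNge => ->.
have : (#|O| * #|Y| < \sum_(l in O) #|F| * #|[set v in Y | v *m l^T == 0%R]|)%N.
  rewrite -sum_nat_const; apply: (@leq_trans (\sum_(l in O) #|Y|.+1)%N).
    by rewrite !sum_nat_const mulnS -[X in (X <= _)%N]add1n leq_add2r.
  exact: leq_sum.
rewrite -big_distrr /=.
have -> : (\sum_(l in O) #|[set v in Y | v *m l^T == 0%R]| =
           \sum_(v in Y) #|F| ^ (n - \rank (col_mx A v)))%N.
  under eq_bigr => l _ do rewrite -sum1_card.
  under eq_bigr => l _ do under eq_bigl => v do rewrite inE.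
  rewrite (exchange_big_dep (mem Y)) /= => [|l v _ /andP[]//].
  apply: eq_bigr => v vY; rewrite sum1dep_card -card_orthogonal.
  by apply: eq_card => l; rewrite !inE mul_col_mx_eq0 vY.
rewrite big_distrr /= (eq_bigr (fun=> #|O|)) => [|v vY].
  by rewrite sum_nat_const mulnC ltnn.
have := rank_leq_col (col_mx A v); rewrite rank_col_mx_rV YA //= addn1 => rA.
by rewrite card_orthogonal -expnS -subSn // subSS.
Qed.

Lemma rank_cap_hyperplane (F : fieldType) (n : nat) (L : 'M[F]_n) (l : 'rV[F]_n) :
  (\rank L <= (\rank (L :&: kermx l^T)%MS).+1)%N.
Proof.
have := mxrank_sum_cap L (kermx l^T); have := rank_leq_col (L + kermx l^T)%MS.
rewrite mxrank_ker mxrank_tr; have := rank_leq_row l; have := rank_leq_col l; lia.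
Qed.

Lemma exists_subspace_cut (F : finFieldType) (m n : nat) (A : 'M[F]_(m, n))
    (Y : {set 'rV[F]_n}) (j : nat) :
  (forall v, v \in Y -> ~~ (v <= A)%MS) ->
  exists L : 'M[F]_n, [/\ (A <= L)%MS, (n <= \rank L + j)%N &
    (#|F| ^ j * #|Y :&: rowg L| <= #|Y|)%N].
Proof.
move=> YA; elim: j => [|j [L [AL rL LY]]].
  exists 1%:M; rewrite submx1 mxrank1 addn0 leqnn mul1n; split=> //.
  exact/subset_leq_card/subsetIl.
have [|l Al lY] := @exists_hyperplane_cut F m n A (Y :&: rowg L).
  by move=> v /setIP[/YA].
exists (L :&: kermx l^T)%MS; split.
- by rewrite sub_capmx AL sub_kermx Al eqxx.
- by rewrite addnS -addSn (leq_trans rL) // leq_add2r rank_cap_hyperplane.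
apply: leq_trans LY; rewrite expnSr -mulnA leq_mul2l; apply/orP; right.
apply: leq_trans lY; rewrite leq_mul2l; apply/orP; right; apply: eq_leq.
by apply: eq_card => v; rewrite !inE sub_capmx sub_kermx andbA.
Qed.

Lemma divisible_sections_add_closed (F : finFieldType) (n e : nat)
    (T : {set 'rV[F]_n}) :
  (1 < n)%N -> (3 < #|F|)%N -> (1 < e)%N -> 0 \in T ->
  (forall a v, v \in T -> a *: v \in T) ->
  (forall W : 'M[F]_n, (n < \rank W + e)%N -> (#|F| %| #|T :&: rowg W|)%N) ->
  (#|T| <= 2 * #|F| ^ e)%N -> {in T &, forall u v, u + v \in T}.
Proof.
case: n T => [|[|n]] // T _ q3 e1 T0 TZ Tdvd Tle x y xT yT.
case: (eqVneq x 0) => [->|x0]; first by rewrite add0r.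
case: (boolP (y <= x)%MS) => [/sub_rVP[a ->]|yx].
  by rewrite -{1}(scale1r x) -scalerDl TZ.
pose A := col_mx x y.
have rA : \rank A = 2%N by rewrite rank_col_mx_rV rank_rV x0 yx.
have xA : (x <= A)%MS by apply: submx_trans (addsmxSl x y) _; rewrite addsmxE.
have yA : (y <= A)%MS by apply: submx_trans (addsmxSr x y) _; rewrite addsmxE.
(* After [e - 2] cuts at most 2 q^2 vectors of T remain outside A, where q is [#|F|]; one further
   hyperplane still leaves a codimension below [e], so its section is divisible by q. *)
have [|L [AL rL LT]] := @exists_subspace_cut F _ _ A (T :\: rowg A) (e - 2).
  by move=> v; rewrite !inE => /andP[].
pose X := T :&: rowg L.
have X0 : 0 \in X by rewrite !inE T0 sub0mx.
have XZ a v : v \in X -> a *: v \in X.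
  by rewrite !inE => /andP[/TZ-> vL]; rewrite scalemx_sub.
have dvdX (l : 'rV[F]_n.+2) : (#|F| %| #|[set v in X | v *m l^T == 0%R]|)%N.
  have -> : [set v in X | v *m l^T == 0%R] = T :&: rowg (L :&: kermx l^T)%MS.
    by apply/setP=> v; rewrite !inE sub_capmx sub_kermx andbA.
  apply: Tdvd; rewrite -(subnK e1) addn2 !addnS ltnS -addSn.
  by rewrite (leq_trans rL) // leq_add2r rank_cap_hyperplane.
have gap (l : 'rV[F]_n.+2) : #|[set v in X | v *m l^T == 0%R]| = #|F| \/
             (#|F| ^ 2 <= #|[set v in X | v *m l^T == 0%R]|)%N.
  apply: dvdn_card_scaler_closed (dvdX l); first by rewrite inE X0 mul0mx /=.
  move=> a v; rewrite in_set => /andP[vX /eqP vl].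
  by rewrite in_set XZ // -scalemxAl vl scaler0 eqxx.
have leX : (#|X| <= #|F| ^ 2)%N.
  (* X has at most 3 q^2 vectors, while q^3 - q^2 + 1 exceeds 3 q^2 since q > 3. *)
  case: (hyperplane_gap X0 XZ gap) => // Xbig; exfalso.
  have XA : (#|X| <= #|F| ^ 2 + #|(T :\: rowg A) :&: rowg L|)%N.
    rewrite -rA -card_rowg -(cardsID (rowg A) X); apply: leq_add.
      exact/subset_leq_card/subsetIr.
    apply: subset_leq_card; apply/subsetP=> v.
    by rewrite !inE => /andP[-> /andP[-> ->]].
  have TA : (#|T :\: rowg A| <= 2 * #|F| ^ e)%N.
    by apply: leq_trans Tle; apply/subset_leq_card/subsetDl.
  move: LT TA XA Xbig; rewrite -{2}(subnK e1) expnD.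
  have : (0 < #|F| ^ (e - 2))%N by rewrite expn_gt0 (leq_trans _ q3).
  move: (#|F| ^ (e - 2))%N #|(T :\: rowg A) :&: rowg L| #|T :\: rowg A| => Q a b.
  move: #|X| #|F| q3 => t q q3.
  rewrite (expnS q 2) -mulnn => Q0 h1 h2 h3 h4.
  have h5 : (a <= 2 * (q * q))%N.
    by rewrite -(leq_pmul2l Q0) (leq_trans h1) // (leq_trans h2) // mulnCA.
  by move: q3 h3 h4 h5; clear; nia.
(* The section contains the line of x and also y, so it has more than q vectors and the gap applies;
   by [leX] it is then all of X. *)
have bigX (l : 'rV[F]_n.+2) : A *m l^T = 0 -> (#|F| ^ 2 <= #|[set v in X | v *m l^T == 0%R]|)%N.
  move=> Al; have /andP[/eqP xl /eqP yl] : (x *m l^T == 0) && (y *m l^T == 0).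
    by rewrite -mul_col_mx_eq0 Al.
  have : (#|F| < #|[set v in X | v *m l^T == 0%R]|)%N.
    have <- : #|rowg x| = #|F| by rewrite card_rowg rank_rV x0 expn1.
    apply: proper_card; apply/properP; split.
      apply/subsetP=> v; rewrite mem_rowg => /sub_rVP[a ->].
      rewrite !inE TZ // -scalemxAl xl scaler0 eqxx andbT /=.
      by rewrite scalemx_sub // (submx_trans xA).
    by exists y; rewrite ?mem_rowg // !inE yT yl eqxx (submx_trans yA).
  by case: (gap l) => // ->; rewrite ltnn.
have SX (l : 'rV[F]_n.+2) : A *m l^T = 0 -> [set v in X | v *m l^T == 0%R] = X.
  move=> Al; apply/eqP; rewrite eqEcard (leq_trans leX (bigX l Al)) andbT.
  by apply/subsetP=> w; rewrite inE => /andP[].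
(* Every form killing A kills X, whereas a vector outside A would cut down the space of such
   forms. *)
have XA v : v \in X -> (v <= A)%MS.
  move=> vX; apply: contraT => vA.
  have := card_orthogonal (col_mx A v); rewrite rank_col_mx_rV vA rA.
  have -> : [set l : 'rV[F]_n.+2 | col_mx A v *m l^T == 0%R] = [set l | A *m l^T == 0%R].
    apply/setP=> l; rewrite !inE mul_col_mx_eq0 andb_idr // => /eqP Al.
    by move: vX; rewrite -(SX l Al) inE => /andP[].
  rewrite card_orthogonal rA => /eqP; rewrite eqn_exp2l; last exact: ltnW (ltnW q3).
  have := rank_leq_col (col_mx A v); rewrite rank_col_mx_rV vA rA /=; clear; lia.
have XAE : X = rowg A.
  apply/eqP; rewrite eqEcard; apply/andP; split.
    by apply/subsetP=> v /XA; rewrite mem_rowg.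
  have A0 : A *m (0 : 'rV[F]_n.+2)^T = 0 by rewrite trmx0 mulmx0.
  by rewrite card_rowg rA -(SX 0 A0) bigX.
have : x + y \in X by rewrite XAE mem_rowg addmx_sub.
by rewrite inE => /andP[].
Qed.

(** * Power sums over a finite field and Jamison's bound *)

Lemma natr_card_finField (F : finFieldType) : #|F|%:R = 0 :> F.
Proof.
(* Translating the summation variable by 1 adds [#|F|] ones to the sum of all elements. *)
apply: (@addrI F (\sum_(b : F) b)); rewrite addr0.
rewrite [RHS](reindex_inj (addIr 1)) big_split /= sumr_const.
by rewrite cardT -cardE.
Qed.

Lemma sum_expr_finField (F : finFieldType) (i : nat) :
  (i < #|F| - 1)%N -> \sum_(b : F) b ^+ i = 0.
Proof.
case: i => [|i] iq.
  (* The term at b = 0 is also 1, so the sum is [#|F|] in [F]. *)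
  under eq_bigr do rewrite expr0.
  by rewrite sumr_const natr_card_finField.
(* The roots of unity of this order are too few to exhaust the nonzero elements; scaling the
   variable by g then multiplies the sum by a factor other than 1. *)
have /existsP[g /andP[g0 gi]] : [exists g : F, (g != 0) && (g ^+ i.+1 != 1)].
  apply: contraLR iq => /existsPn H; rewrite -leqNgt.
  have := @max_unity_roots F i.+1 (enum [set~ (0 : F)]) isT.
  rewrite -cardE cardsC1 subn1; apply; last exact: enum_uniq.
  apply/allP=> g; rewrite mem_enum !inE => g0; rewrite unity_rootE.
  by have := H g; rewrite g0 /= negbK.
set S := \sum_b _; have : g ^+ i.+1 * S = S.
  rewrite /S mulr_sumr [RHS](reindex_inj (mulfI g0)).
  by apply: eq_bigr => b _; rewrite exprMn.
move/eqP; rewrite -subr_eq0 -{2}(mul1r S) -mulrBl mulf_eq0 subr_eq0 (negPf gi).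
by move/eqP.
Qed.

(** The monomial makes the induction go through: expanding one form raises i or j by at most one.
    With no form left, i or j is below [#|F| - 1] and its power sum vanishes. *)
Lemma sum_prod_affine_forms (F : finFieldType) (s : seq (F * F)) (i j : nat) :
  (i + j + size s < 2 * (#|F| - 1))%N ->
  \sum_(b : F) \sum_(c : F)
     b ^+ i * c ^+ j * \prod_(z <- s) (1 + b * z.1 + c * z.2) = 0.
Proof.
elim: s i j => [|z s IH] i j lt.
  under eq_bigr do under eq_bigr do rewrite big_nil mulr1.
  under eq_bigr do rewrite -mulr_sumr.
  rewrite -mulr_suml; move: lt; rewrite addn0 => lt.
  case: (ltnP i (#|F| - 1)) => hi; first by rewrite sum_expr_finField // mul0r.
  rewrite [X in _ * X]sum_expr_finField ?mulr0 //.
  by move: lt hi; move: (#|F| - 1)%N => r; lia.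
move: lt; rewrite /= addnS => lt.
have E b c : b ^+ i * c ^+ j * \prod_(z <- z :: s) (1 + b * z.1 + c * z.2) =
  b ^+ i * c ^+ j * \prod_(z <- s) (1 + b * z.1 + c * z.2) +
  z.1 * (b ^+ i.+1 * c ^+ j * \prod_(z <- s) (1 + b * z.1 + c * z.2)) +
  z.2 * (b ^+ i * c ^+ j.+1 * \prod_(z <- s) (1 + b * z.1 + c * z.2)).
  by rewrite big_cons !exprS; ring.
under eq_bigr do under eq_bigr do rewrite E.
under eq_bigr do rewrite !big_split /= -!mulr_sumr.
rewrite !big_split /= -!mulr_sumr !IH ?mulr0 ?addr0 //;
  by move: lt; move: (#|F| - 1)%N => r; lia.
Qed.

(* Jamison's theorem on affine blocking sets of the plane: the product of the
   forms would be the indicator of (0, 0), of degree at least 2 (q - 1). *)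
Lemma exists_unblocked_line (F : finFieldType) (s : seq (F * F)) :
  (size s < 2 * (#|F| - 1))%N ->
  exists b c, ((b != 0) || (c != 0)) &&
    all (fun z => 1 + b * z.1 + c * z.2 != 0) s.
Proof.
move=> ss; suff /existsP[b /existsP[c bc]] : [exists b : F, exists c : F,
    ((b != 0) || (c != 0)) && all (fun z => 1 + b * z.1 + c * z.2 != 0) s].
  by exists b, c.
apply: contraT => /existsPn H.
have := @sum_prod_affine_forms F s 0 0; rewrite !add0n => /(_ ss).
have Z b c : (b != 0) || (c != 0) -> \prod_(z <- s) (1 + b * z.1 + c * z.2) = 0.
  move=> bc; have /existsPn/(_ c) := H b; rewrite bc /= -has_predC => /hasP[z zs].
  by rewrite /= negbK => /eqP z0; rewrite (big_rem z) //= z0 mul0r.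
rewrite (bigD1 0) //= (bigD1 0) //= !mul1r !big1.
- by move/eqP; rewrite !addr0 oner_eq0.
- by move=> b b0; rewrite big1 // => c _; rewrite Z ?mulr0 // b0.
- by move=> c c0; rewrite Z ?mulr0 // c0 orbT.
by move=> z _; rewrite !mul0r !addr0.
Qed.

(** * Functions of small support whose sums over large subspaces vanish *)

Lemma exists_functional (F : fieldType) (r m : nat) (A : 'M[F]_(r, m)) (w : 'rV[F]_m) :
  ~~ (w <= A)%MS ->
  exists2 l : 'cV[F]_m, A *m l = 0 & w *m l = 1%:M.
Proof.
rewrite submxE => /matrix0Pn[i [j]]; rewrite (ord1 i) => wj.
pose l := ((w *m cokermx A) 0 j)^-1 *: (cokermx A *m delta_mx j (0 : 'I_1)); exists l.
  by rewrite /l -scalemxAr (mulmxA A) mulmx_coker mul0mx scaler0.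
apply/matrixP=> x y; rewrite !ord1 /l -scalemxAr (mulmxA w (cokermx A)) -colE [LHS]mxE.
by rewrite [X in _ * X]mxE mulVf // mxE.
Qed.

Lemma sub_rV_sym (F : fieldType) (m : nat) (u v : 'rV[F]_m) :
  u != 0 -> (u <= v)%MS -> (v <= u)%MS.
Proof. by move=> u0; rewrite -eq_genmx_rV // => /eqP uv; rewrite -(genmxE u) uv genmxE. Qed.

Lemma sub_adds_rV (F : fieldType) (r m : nat) (A : 'M[F]_(r, m)) (w v : 'rV[F]_m) :
  (v <= A + w)%MS -> exists a, (v - a *: w <= A)%MS.
Proof.
case/sub_addsmxP=> u ->; exists (u.2 0 0); rewrite {1}[u.2]mx11_scalar.
by rewrite mul_scalar_mx addrK submxMl.
Qed.

(** Pigeonhole: [T :\: rowg M] is distributed over the nonzero cosets of M, which are the nonzero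
    values of [cokermx M]. *)
Lemma exists_light_coset (F : finFieldType) (m : nat) (T : {set 'rV[F]_m})
    (M : 'M[F]_m) (s : nat) :
  (#|T :\: rowg M| < s.+1 * (#|F| ^ (m - \rank M) - 1))%N ->
  exists2 w : 'rV[F]_m, ~~ (w <= M)%MS & (#|[set t in T | ((t - w)%R <= M)%MS]| <= s)%N.
Proof.
move=> lt; set C := cokermx M.
case: (pickP [pred w : 'rV[F]_m | ~~ (w <= M)%MS && (#|[set t in T | ((t - w)%R <= M)%MS]| <= s)%N])
  => [w /andP[wM ws]|none]; first by exists w.
exfalso; move: lt; apply/negP; rewrite -leqNgt -mxrank_coker -card_rowg.
have -> : (#|rowg C| - 1)%N = #|rowg C :\ 0|.
  by rewrite (cardsD1 0 (rowg C)) mem_rowg sub0mx addKn.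
rewrite -[X in (_ <= X)%N]sum1_card mulnC -sum_nat_const.
rewrite [X in (_ <= X)%N](partition_big (fun t => t *m C) (mem (rowg C :\ 0))) /=; last first.
  by move=> t; rewrite !inE submxE => /andP[-> _]; rewrite submxMl.
apply: leq_sum => y; rewrite !inE => /andP[y0 /submxP[w yw]].
have wM : ~~ (w <= M)%MS by rewrite submxE -/C -yw.
have := none w; rewrite /= wM /= => /negbT; rewrite -ltnNge sum1dep_card.
move=> /leq_trans; apply; apply: subset_leq_card; apply/subsetP=> t.
rewrite !inE => /andP[-> tw]; rewrite andbT; apply/andP; split.
  by apply: contra wM => tM; rewrite -[w](subKr t) addmx_sub // -scaleN1r scalemx_sub.
by rewrite yw -subr_eq0 -mulmxBl -submxE.
Qed.

Section SmallSupport.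

Variables (F : finFieldType) (R : nzRingType) (m k : nat) (f : 'rV[F]_m -> R).
Let q := #|F|.
Let T := [set v | f v != 0].
Hypotheses (qR : q%:R = 0 :> R) (k0 : (0 < k)%N) (km : (k.+1 < m)%N).
Hypothesis fZ : forall a v, a != 0 -> f (a *: v) = f v.
Hypothesis fsum : forall A : 'M[F]_m, (m <= \rank A + k)%N ->
  \sum_(v in rowg A) f v = 0.
Hypothesis f0 : f 0 != 0.
(** For [#|T|] = w (q - 1) + 1 this says w < 2 q^k. *)
Hypothesis cardT : (#|T| + (q - 1) <= 2 * q ^ k * (q - 1) + 1)%N.

Let q1 : (1 < q)%N := finNzRing_gt1 F.

Let T0 : 0 \in T. Proof. by rewrite inE. Qed.

Let TZ a v : v \in T -> a *: v \in T.
Proof.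
rewrite !inE; case: (eqVneq a 0) => [->|a0]; first by rewrite scale0r.
by rewrite fZ.
Qed.

Let sub_line_eq (P v : 'rV[F]_m) : v \in rowg P :\ 0 -> f v = f P.
Proof.
rewrite !inE => /andP[v0 /sub_rVP[a va]]; rewrite va fZ //.
by apply: contraNneq v0 => a0; rewrite va a0 scale0r.
Qed.

Let sum_line (P : 'rV[F]_m) : P != 0 -> \sum_(v in rowg P :\ 0) f v = - f P.
Proof.
move=> P0; rewrite (eq_bigr (fun=> f P)) => [|v]; last exact: sub_line_eq.
rewrite sumr_const; apply/eqP; rewrite -addr_eq0 -mulrSr.
have -> : #|rowg P :\ 0|.+1 = q.
  have := cardsD1 0 (rowg P).
  by rewrite card_rowg mem_rowg sub0mx rank_rV P0 expn1 add1n => <-.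
by rewrite -mulr_natr qR mulr0.
Qed.

(** The line of P contributes (q - 1) f P = - f P to a vanishing sum. P is not assumed to lie in A:
    otherwise the sum would be [f 0] alone, which is nonzero. *)
Lemma tangent_value (A : 'M[F]_m) (P : 'rV[F]_m) :
  P != 0 -> (m <= \rank A + k)%N ->
  (forall v, v \in T -> (v <= A)%MS -> (v <= P)%MS) -> f P = f 0.
Proof.
move=> P0 rA AP; have := fsum rA; rewrite (bigD1 0) ?mem_rowg ?sub0mx //=.
case: (boolP (P <= A)%MS) => PA.
  suff -> : \sum_(i in rowg A | i != 0) f i = - f P by move/eqP; rewrite subr_eq0 => /eqP.
  rewrite -(sum_line P0) [RHS]big_mkcond [LHS]big_mkcond; apply: eq_bigr => v _.
  rewrite !inE; case: (eqVneq v 0) => [->|v0]; first by rewrite andbF.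
  rewrite andbT /=; case: (boolP (v <= P)%MS) => vP; first by rewrite (submx_trans vP).
  case: ifP => // vA; apply/eqP; apply: contraNT vP => fv.
  by apply: AP; rewrite ?inE.
rewrite big1 ?addr0 => [/eqP|v]; first by rewrite (negPf f0).
rewrite mem_rowg => /andP[vA v0]; apply/eqP; apply: contraNT PA => fv.
have vP : (v <= P)%MS by apply: AP; rewrite ?inE.
exact: submx_trans (sub_rV_sym v0 vP) vA.
Qed.

Lemma bisecant_value (A : 'M[F]_m) (P Q : 'rV[F]_m) :
  P != 0 -> ~~ (Q <= P)%MS -> (P <= A)%MS -> (Q <= A)%MS ->
  (m <= \rank A + k)%N ->
  (forall v, v \in T -> (v <= A)%MS -> (v <= P)%MS || (v <= Q)%MS) ->
  f P + f Q = f 0.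
Proof.
move=> P0 QP PA QA rA APQ; have := fsum rA; rewrite (bigD1 0) ?mem_rowg ?sub0mx //=.
have Q0 : Q != 0 by apply: contraNneq QP => ->; apply: sub0mx.
suff -> : \sum_(i in rowg A | i != 0) f i = - f P - f Q.
  by move/eqP; rewrite -opprD subr_eq0 => /eqP.
have QP' v : v \in rowg Q :\ 0 -> v \notin rowg P :\ 0.
  rewrite !inE => /andP[v0 vQ]; rewrite v0 /=; apply: contra QP => vP.
  exact: submx_trans (sub_rV_sym v0 vQ) vP.
rewrite -(sum_line P0) -(sum_line Q0) -bigU /=; last first.
  by rewrite disjoint_sym disjoint_subset; apply/subsetP=> v vQ; apply: QP'.
rewrite [RHS]big_mkcond [LHS]big_mkcond; apply: eq_bigr => v _.
rewrite !inE; case: (eqVneq v 0) => [->|v0]; first by rewrite andbF.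
rewrite andbT /=; case: (boolP (v <= A)%MS) => vA; case: ifP => //.
  move=> /negbT nPQ; apply/eqP; apply: contraNT nPQ => fv.
  by apply: APQ; rewrite ?inE.
by case/orP=> vl; move: vA; rewrite (submx_trans vl).
Qed.

(* A line of a plane blocked by fewer than [2q] points carries a point lying on
   a tangent (Jamison), so a bisecant cannot join two points without tangent. *)
Lemma value_constant_on_support (Q : 'rV[F]_m) : Q != 0 -> f Q != 0 -> f Q = f 0.
Proof.
move=> Q0 fQ; have QT : Q \in T by rewrite inE.
(* Up to a scalar, a vector of T in M + w but outside M lies in the coset of w, so a light coset
   bounds what adjoining w brings in. *)
have sub_coset (M : 'M[F]_m) (w v : 'rV[F]_m) : v \in T -> (v <= M + w)%MS ->
    (v <= M)%MS \/ exists a, [/\ a != 0, a *: v \in T & (a *: v - w <= M)%MS].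
  move=> vT /sub_adds_rV[a vM]; case: (eqVneq a 0) => a0.
    by left; move: vM; rewrite a0 scale0r subr0.
  right; exists a^-1; rewrite invr_eq0 a0 TZ //; split=> //.
  have -> : a^-1 *: v - w = a^-1 *: (v - a *: w).
    by rewrite scalerBr scalerA mulVf // scale1r.
  exact: scalemx_sub.
have rank_adds (M : 'M[F]_m) (w : 'rV[F]_m) : ~~ (w <= M)%MS ->
    \rank (M + w)%MS = (\rank M).+1.
  by move=> wM; rewrite addsmxE rank_col_mx_rV wM addn1.
have cardQ (M : 'M[F]_m) : (Q <= M)%MS -> (#|T :\: rowg M| + q <= #|T|)%N.
  move=> QM; rewrite -(cardsID (rowg M) T) addnC leq_add2r.
  have <- : #|rowg Q| = q by rewrite card_rowg rank_rV Q0 expn1.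
  apply: subset_leq_card; apply/subsetP=> v; rewrite mem_rowg => vQ.
  rewrite inE mem_rowg (submx_trans vQ QM) andbT.
  by case/sub_rVP: vQ => a ->; apply: TZ.
(* Grow M from the line of Q: while the codimension is at least k + 2, T is too small to meet every
   nonzero coset. *)
have [M [QM rM TM]] : exists M : 'M[F]_m, [/\ (Q <= M)%MS, \rank M = (m - k.+1)%N &
    forall v, v \in T -> (v <= M)%MS -> (v <= Q)%MS].
  have : (0 < m - k.+1)%N by rewrite subn_gt0.
  have : (m - k.+1 <= m - k.+1)%N by [].
  elim: {1 3 4}(m - k.+1)%N => // -[|j] IH jm _.
    by exists <<Q>>%MS; rewrite !genmxE rank_rV Q0; split=> // v _; rewrite genmxE.
  have [M [QM rM TM]] := IH (ltnW jm) isT.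
  have [|w wM] := @exists_light_coset F m T M 0.
    rewrite mul1n rM.
    have := cardQ M QM; move: cardT; rewrite -/q.
    have : (q ^ k.+2 <= q ^ (m - j.+1))%N.
      by rewrite leq_pexp2l ?(ltnW q1) //; move: jm km; clear; lia.
    rewrite !expnS; have : (0 < q ^ k)%N by rewrite expn_gt0 ltnW.
    move: (q ^ k)%N (q ^ (m - j.+1))%N #|T| #|T :\: _| q q1; clear; nia.
  rewrite leqn0 => /eqP/cards0_eq wT; exists (M + w)%MS; split.
  - exact: submx_trans QM (addsmxSl _ _).
  - by rewrite rank_adds // rM.
  move=> v vT /(sub_coset _ _ _ vT)[|[a [a0 avT avw]]]; first exact: TM.
  by move/setP: wT => /(_ (a *: v)); rewrite inE avT avw inE.
have cQk := cardQ M QM.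
(* In codimension k + 1 an empty coset is no longer guaranteed, but one with at most one vector
   is. *)
have [|w wM wT] := @exists_light_coset F m T M 1.
  rewrite rM subKn; last exact: ltnW.
  move: cQk cardT; rewrite -/q expnS; have : (0 < q ^ k)%N by rewrite expn_gt0 ltnW.
  move: (q ^ k)%N #|T| #|T :\: _| q q1; clear; nia.
pose P := (M + w)%MS.
have QP : (Q <= P)%MS := submx_trans QM (addsmxSl _ _).
have rP : \rank P = (m - k)%N by rewrite rank_adds // rM -subSn // ltnW.
have rPk : (m <= \rank P + k)%N by rewrite rP subnK // ltnW // ltnW.
case: (set_0Vmem [set t in T | ((t - w)%R <= M)%MS]) => [wT0|[S]].
  apply: (tangent_value Q0 rPk) => v vT /(sub_coset _ _ _ vT)[|[a [a0 avT avw]]].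
    exact: TM.
  by move/setP: wT0 => /(_ (a *: v)); rewrite inE avT avw inE.
move=> Sw; have {wT} wT : [set t in T | ((t - w)%R <= M)%MS] = [set S].
  by apply/eqP; rewrite eq_sym eqEcard sub1set Sw cards1.
move: Sw; rewrite inE => /andP[ST Sw].
have SM : ~~ (S <= M)%MS.
  by apply: contra wM => SM; rewrite -[w](subKr S) addmx_sub // -scaleN1r scalemx_sub.
have S0 : S != 0 by apply: contraNneq SM => ->; apply: sub0mx.
have SQ : ~~ (S <= Q)%MS by apply: contra SM => SQ; apply: submx_trans QM.
have QS : ~~ (Q <= S)%MS by apply: contra SQ; apply: sub_rV_sym.
have SP : (S <= P)%MS by rewrite -(subrK w S) addmx_sub_adds.
have TP v : v \in T -> (v <= P)%MS -> (v <= Q)%MS || (v <= S)%MS.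
  move=> vT /(sub_coset _ _ _ vT)[/(TM v vT)->//|[a [a0 avT avw]]].
  have : a *: v \in [set S] by rewrite -wT inE avT.
  rewrite inE => /eqP avS; apply/orP; right.
  by rewrite -(scale1r v) -(mulVf a0) -scalerA avS scalemx_sub.
have fQS := bisecant_value Q0 SQ QP SP rPk TP.
(* 2 q - 3 is the largest number of points that [exists_unblocked_line] allows. *)
have [|u uP uT] := @exists_light_coset F m T P (2 * q - 3).
  have : (#|T :\: rowg P| + q + (q - 1) <= #|T|)%N.
    rewrite -(cardsID (rowg P) T) -addnA addnC leq_add2r.
    have <- : #|rowg Q :|: (rowg S :\ 0)| = (q + (q - 1))%N.
      rewrite cardsU (_ : _ :&: _ = set0) ?cards0 ?subn0.
        have := cardsD1 0 (rowg S); rewrite mem_rowg sub0mx !card_rowg !rank_rV Q0 S0.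
        by rewrite !expn1 -/q => ->; rewrite addKn.
      apply/setP=> v; rewrite !inE; apply/negbTE/and3P => -[vQ v0 vS].
      by case/negP: SQ; apply: submx_trans (sub_rV_sym v0 vS) vQ.
    apply: subset_leq_card; apply/subsetP=> v; rewrite !in_setU in_setD1 !mem_rowg in_setI mem_rowg.
    case/orP=> [vQ|/andP[_ vS]]; first rewrite (submx_trans vQ QP) andbT.
      by case/sub_rVP: vQ => a ->; apply: TZ.
    rewrite (submx_trans vS SP) andbT.
    by case/sub_rVP: vS => a ->; apply: TZ.
  rewrite rP subKn; last exact: ltnW (ltnW km).
  have qk : (0 < q ^ k)%N by rewrite expn_gt0 ltnW.
  have -> : ((2 * q - 3).+1 = 2 * (q - 1))%N by move: q q1; clear; lia.
  have r0 : (0 < q - 1)%N by rewrite subn_gt0.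
  rewrite mulnBr muln1; move: cardT r0; rewrite mulnAC -/q.
  have : (2 * (q - 1) <= 2 * (q - 1) * q ^ k)%N by rewrite leq_pmulr.
  move: q1; move: (2 * (q - 1) * q ^ k)%N #|T| #|T :\: _| q; clear; lia.
set Phi := [set t in T | ((t - u)%R <= P)%MS] in uT.
(* x and y are coordinates dual to Q and S; they project the coset of u to an affine plane with
   origin u. *)
have [x Sx Qx] := exists_functional QS.
have [y Qy Sy] := exists_functional SQ.
have [l Pl ul] := exists_functional uP.
pose X (v : 'rV[F]_m) := (v *m x) 0 0; pose Y (v : 'rV[F]_m) := (v *m y) 0 0.
have [|b [c /andP[bc /allP nz]]] :=
  @exists_unblocked_line F [seq (X t - X u, Y t - Y u) | t <- enum Phi].
  by rewrite size_map -cardE; move: uT q1; rewrite -/q; move: #|Phi| q; clear; lia.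
pose g := b *: x + c *: y + (1 - b * X u - c * Y u) *: l.
have gE v : (v *m g) 0 0 = b * X v + c * Y v + (1 - b * X u - c * Y u) * (v *m l) 0 0.
  have mxD (A B : 'M[F]_1) : (A + B) 0 0 = A 0 0 + B 0 0 by rewrite mxE.
  have mxZ a (A : 'M[F]_1) : (a *: A) 0 0 = a * A 0 0 by rewrite mxE.
  by rewrite /g !mulmxDr -!scalemxAr !mxD !mxZ.
pose W := ((P + u) :&: kermx g)%MS.
have rW : (m <= \rank W + k)%N.
  have := rank_cap_hyperplane (P + u)%MS g^T; rewrite trmxK rank_adds // rP ltnS => rW.
  by apply: leq_trans (leq_add rW (leqnn k)); rewrite subnK // ltnW // ltnW.
have TW v : v \in T -> (v <= W)%MS -> ((v <= Q)%MS || (v <= S)%MS) && ((v *m g) 0 0 == 0).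
  move=> vT; rewrite sub_capmx sub_kermx => /andP[vPu /eqP vg]; rewrite vg mxE eqxx andbT.
  case: (sub_coset _ _ _ vT vPu) => [|[a [a0 avT avu]]]; first exact: TP.
  exfalso; have /nz : (X (a *: v) - X u, Y (a *: v) - Y u) \in
      [seq (X t - X u, Y t - Y u) | t <- enum Phi].
    by apply: (map_f (fun t => (X t - X u, Y t - Y u))); rewrite mem_enum inE avT.
  case/negP; apply/eqP => /=; transitivity (((a *: v) *m g) 0 0); last first.
    by rewrite -scalemxAl vg scaler0 mxE.
  rewrite gE; have -> : ((a *: v) *m l) 0 0 = 1.
    rewrite -(subrK u (a *: v)) mulmxDl ul; case/submxP: avu => D ->.
    by rewrite -mulmxA Pl mulmx0 add0r mxE.
  by ring.
have [PlQ PlS] : Q *m l = 0 /\ S *m l = 0.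
  by split; [case/submxP: QP|case/submxP: SP] => D ->; rewrite -mulmxA Pl mulmx0.
have gQ : (Q *m g) 0 0 = b by rewrite gE /X /Y Qx Qy PlQ !mxE /=; ring.
have gS : (S *m g) 0 0 = c by rewrite gE /X /Y Sx Sy PlS !mxE /=; ring.
have line_eq0 (Z v : 'rV[F]_m) : (v <= Z)%MS -> (v *m g) 0 0 = 0 -> (Z *m g) 0 0 != 0 -> v = 0.
  case/sub_rVP=> a ->; rewrite -scalemxAl mxE => /eqP.
  by rewrite mulf_eq0 => /orP[/eqP->|->//]; rewrite scale0r.
case: (eqVneq b 0) => b0.
  apply: (tangent_value Q0 rW) => v vT /(TW v vT)/andP[/orP[//|vS] /eqP vg].
  by rewrite (line_eq0 _ _ vS vg) ?sub0mx // gS; move: bc; rewrite b0 eqxx.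
(* Here Q is not in W. S may also be missing, a case that [tangent_value] covers. Then f Q + f S = f
   0 forces f Q = 0. *)
exfalso; have fS : f S = f 0.
  apply: (tangent_value S0 rW) => v vT /(TW v vT)/andP[/orP[vQ|//] /eqP vg].
  by rewrite (line_eq0 _ _ vQ vg) ?sub0mx // gQ.
by move: fQS fQ; rewrite fS -{2}(add0r (f 0)) => /addIr ->; rewrite eqxx.
Qed.

End SmallSupport.

(** * Prime field coordinates, and combinations of subspace indicators *)

Lemma exists_prime_field_coordinates (F : finFieldType) (p m : nat) :
  p \in [pchar F] ->
  exists h, #|F| = (p ^ h)%N /\
    exists E : 'rV[F]_m -> 'rV['F_p]_(m * h), {morph E : u v / u + v} /\ bijective E.
Proof.
move=> pF; have pp := pcharf_prime pF.
have cF : #|F| = (p ^ logn p #|F|)%N := card_pprimeChar pF.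
have [e e_lin e_bij] := pprimeChar_vectAxiom pF.
exists (logn p #|F|); split=> //.
pose E (v : 'rV[F]_m) := mxvec (\matrix_(i < m) (e (v 0 i) : 'rV['F_p]_(logn p #|F|))).
have eD (x y : F) : e (x + y) = e x + e y.
  by have := e_lin 1 x y; rewrite !scale1r.
exists E; split=> [u v|].
  rewrite /E -linearD; congr mxvec; apply/row_matrixP=> i.
  by rewrite linearD /= !rowK mxE eD.
apply: inj_card_bij => [u v uv|].
  apply/rowP=> i; apply: (bij_inj e_bij).
  by have /(congr1 (row i)) := can_inj mxvecK uv; rewrite !rowK.
by rewrite !card_mx card_Fp // !mul1n {2}cF -expnM mulnC.
Qed.

Lemma rank_capmx_gt0 (F : fieldType) (m1 m2 n : nat) (A : 'M[F]_(m1, n)) (B : 'M[F]_(m2, n)) :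
  (n < \rank A + \rank B)%N -> (0 < \rank (A :&: B)%MS)%N.
Proof. by rewrite -mxrank_sum_cap; have := rank_leq_col (A + B)%MS; lia. Qed.

Section PointsAndVectors.

Variables (F : finFieldType) (p n : nat).
Hypothesis pF : p \in [pchar F].

Let pp : prime p := pcharf_prime pF.

Lemma card_finField_pchar : exists2 h, (0 < h)%N & #|F| = (p ^ h)%N.
Proof.
have cF : #|F| = (p ^ logn p #|F|)%N := card_pprimeChar pF.
exists (logn p #|F|) => //; rewrite lt0n; apply: contraTneq (finNzRing_gt1 F) => l0.
by rewrite cF l0.
Qed.

Lemma point_repr (x : point F n) : exists2 v : 'rV[F]_n.+1, v != 0 & val x = <<v>>%MS.
Proof.
have /andP[/eqP xx /eqP rx] : (<<val x>>%MS == val x) && (\rank (val x) == 1%N).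
  by have := valP x; rewrite inE.
have /rowV0Pn[v vx v0] : val x != 0 by rewrite -mxrank_eq0 rx.
exists v => //; rewrite -xx; apply/eq_genmx/eqmx_sym.
by apply/eqmxP; rewrite -(geq_leqif (mxrank_leqif_eq vx)) rx rank_rV v0.
Qed.

Lemma card_points (D : {set point F n}) (Z : {set 'rV[F]_n.+1}) :
  (forall x v, v != 0 -> val x = <<v>>%MS -> (x \in D) = (v \in Z)) ->
  #|[set <<v>>%MS | v in Z :\ 0]| = #|D|.
Proof.
move=> DZ; rewrite -[RHS](card_imset _ val_inj); apply: eq_card => A.
apply/imsetP/imsetP => -[].
  move=> v /setD1P[v0 vZ] ->.
  have vp : <<v>>%MS \in proj_subspaces F n.+1 0.
    by rewrite inE genmx_id eqxx mxrank_gen rank_rV v0.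
  by exists (Sub <<v>>%MS vp) => //; rewrite (DZ _ v).
move=> x xD ->; have [v v0 xv] := point_repr x.
by exists v => //; rewrite !inE v0 -(DZ x).
Qed.

(** With s points, s (q - 1) + 1 is a positive power of q = [#|F|]; modulo p this reads 1 - s =
    0. *)
Lemma natr_card_points (A : 'M[F]_n.+1) :
  (0 < \rank A)%N -> #|[set x : point F n | (val x <= A)%MS]|%:R = 1 :> 'F_p.
Proof.
move=> rA; rewrite -(@card_points _ (rowg A)) => [|x v v0 xv]; last first.
  by rewrite inE mem_rowg xv genmxE.
have [h h0 cF] := card_finField_pchar.
have qp : #|F|%:R = 0 :> 'F_p.
  by rewrite cF natrX pchar_Fp_0 ?expr0n ?eqn0Ngt ?h0.
have A0 : 0 \in rowg A by rewrite mem_rowg sub0mx.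
have AZ a v : v \in rowg A -> a *: v \in rowg A.
  by rewrite !mem_rowg; apply: scalemx_sub.
have := card_scaler_closed A0 AZ; rewrite card_rowg => /(congr1 (fun x => x%:R : 'F_p)).
rewrite natrX qp expr0n eqn0Ngt rA.
rewrite mulrSr natrM natrB ?(ltnW (finNzRing_gt1 F)) // qp sub0r mulrN1 /= => /eqP.
by rewrite eq_sym addrC subr_eq0 => /eqP.
Qed.

Section SubspaceCombination.

Variables (k : nat) (a : 'M[F]_n.+1 -> 'F_p).
Local Notation Ks := (proj_subspaces F n.+1 k).
Let f (v : 'rV[F]_n.+1) : 'F_p := \sum_(K in Ks) a K * (v <= K)%MS%:R.

Let rankK K : K \in Ks -> \rank K = k.+1.
Proof. by rewrite inE => /andP[_ /eqP]. Qed.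

Lemma sum_subspace_comb (Z : {set 'rV[F]_n.+1}) :
  (forall K, K \in Ks -> p %| #|Z :&: rowg K|)%N -> \sum_(v in Z) f v = 0.
Proof.
move=> pZ; rewrite /f exchange_big big1 //= => K /pZ.
rewrite (dvdn_pcharf (pchar_Fp pp)) => /eqP ZK.
transitivity (a K * #|Z :&: rowg K|%:R); last by rewrite ZK mulr0.
rewrite -mulr_sumr; congr (_ * _).
rewrite -sum1_card natr_sum [LHS]big_mkcond [RHS]big_mkcond; apply: eq_bigr => v _.
by rewrite in_setI mem_rowg; case: (v \in Z); case: (v <= K)%MS.
Qed.

(** A meets each K nontrivially, in a positive power of [#|F|] vectors. *)
Lemma sum_subspace_comb_rowg (A : 'M[F]_n.+1) :
  (n.+1 <= \rank A + k)%N -> \sum_(v in rowg A) f v = 0.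
Proof.
move=> rA; apply: sum_subspace_comb => K /rankK rK.
have [h h0 cF] := card_finField_pchar.
rewrite -rowgI card_rowg cF -expnM dvdn_exp // muln_gt0 h0 /=.
by apply: rank_capmx_gt0; rewrite rK addnS.
Qed.

(** Same argument over the prime field, where K has dimension [k.+1 * h]; W need not come from a
    subspace over [F]. *)
Lemma sum_subspace_comb_prime_rowg (h N : nat) (E : 'rV[F]_n.+1 -> 'rV['F_p]_N)
    (W : 'M['F_p]_N) :
  #|F| = (p ^ h)%N -> {morph E : u v / u + v} -> bijective E ->
  (N < \rank W + k.+1 * h)%N -> \sum_(v in E @^-1: rowg W) f v = 0.
Proof.
move=> cF ED Ebij rW; apply: sum_subspace_comb => K KKs.
have E0 : E 0 = 0 by apply: (addrI (E 0)); rewrite -ED !addr0.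
have EMn v j : E (v *+ j) = E v *+ j by elim: j => [|j IH]; rewrite ?mulr0n // !mulrS ED IH.
have [] := @scaler_add_closed_rowg _ _ (E @: rowg K).
- by rewrite -E0 imset_f // mem_rowg sub0mx.
(* Scalars of ['F_p] act as integer multiples, which an additive map preserves. *)
- move=> b _ /imsetP[v vK ->]; rewrite -(natr_Zp b) scaler_nat -EMn imset_f //.
  by rewrite mem_rowg -scaler_nat scalemx_sub // -mem_rowg.
- move=> _ _ /imsetP[u uK ->] /imsetP[v vK ->]; rewrite -ED imset_f //.
  by move: uK vK; rewrite !mem_rowg; apply: addmx_sub.
move=> B EB.
have rB : \rank B = (k.+1 * h)%N.
  have := card_rowg B; rewrite -EB (card_imset _ (bij_inj Ebij)) card_rowg rankK //.
  rewrite cF card_Fp // -expnM => /eqP; rewrite eqn_exp2l ?prime_gt1 // => /eqP <-.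
  by rewrite mulnC.
have -> : #|E @^-1: rowg W :&: rowg K| = #|rowg (W :&: B)%MS|.
  rewrite -(card_imset _ (bij_inj Ebij)) rowgI -EB; apply: eq_card => y.
  have [v ->] : exists v, y = E v by case: Ebij => G _ GK; exists (G y); rewrite GK.
  by rewrite inE !(mem_imset _ _ (bij_inj Ebij)) !inE.
rewrite card_rowg card_Fp // dvdn_exp //.
by apply: rank_capmx_gt0; rewrite rB.
Qed.

(** S shares with each K a number of points that is 1 modulo p, so the pairing is the sum of all
    [a K]. This is [f 0], as 0 lies in every K. *)
Lemma sum_points_subspace_comb (S : 'M[F]_n.+1) :
  (n < \rank S + k)%N ->
  \sum_(x : point F n | (val x <= S)%MS) \sum_(K in Ks) a K * incid p K x = f 0.
Proof.
move=> rS; rewrite exchange_big /f; apply: eq_bigr => K /rankK rK.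
rewrite -mulr_sumr sub0mx; congr (_ * _).
rewrite -(@natr_card_points (S :&: K)%MS).
  rewrite -sum1_card natr_sum [LHS]big_mkcond [RHS]big_mkcond; apply: eq_bigr => x _.
  by rewrite inE sub_capmx /incid ffunE; case: (_ <= S)%MS; case: (_ <= K)%MS.
by apply: rank_capmx_gt0; rewrite rK addnS.
Qed.

End SubspaceCombination.

End PointsAndVectors.

(** * From the codeword to an impossible subspace size *)

Theorem mainTheorem4 (F : finFieldType) (p n k : nat)
  (hp : prime p) (hp5 : (5 < p)%N) (hchar : p \in [pchar F])
  (hn : (2 <= n)%N) (hk1 : (1 <= k)%N) (hk2 : (k <= n - 1)%N)
  (c : word F n p) :
  in_code k c -> ~ in_dual_code (n - k) c ->
  ~ ((theta #|F| k < wt c)%N /\ (wt c < 2 * #|F| ^ k)%N).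
Proof.
case=> a cE ndual [wt_gt wt_lt].
have kn : (k < n)%N by lia.
set q := #|F| in wt_gt wt_lt; have q1 : (1 < q)%N := finNzRing_gt1 F.
pose f (v : 'rV[F]_n.+1) : 'F_p := \sum_(K in proj_subspaces F n.+1 k) a K * (v <= K)%MS%:R.
have cf x v : val x = <<v>>%MS -> c x = f v.
  move=> xv; rewrite cE; apply: eq_bigr => K _.
  by rewrite /incid ffunE xv genmxE.
have f0 : f 0 != 0.
  (* The scalar product of c with every (n - k)-space is [f 0]. *)
  apply/eqP => f0; apply: ndual => c' [b c'E]; rewrite /dotp.
  under eq_bigr => x _ do rewrite c'E mulr_sumr.
  rewrite exchange_big big1 //= => S; rewrite inE => /andP[_ /eqP rS].
  transitivity (b S * f 0); last by rewrite f0 mulr0.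
  have rSk : (n < \rank S + k)%N by rewrite rS addSn subnK // ltnW.
  rewrite -[f 0](sum_points_subspace_comb hchar a rSk).
  rewrite mulr_sumr [RHS]big_mkcond; apply: eq_bigr => x _.
  rewrite /incid ffunE cE; case: (_ <= S)%MS; last by rewrite !mulr0.
  by rewrite mulr1 mulrC.
have fZ b v : b != 0 -> f (b *: v) = f v.
  by move=> b0; apply: eq_bigr => K _; rewrite (eqmx_scale v b0).
pose T := [set v | f v != 0].
have T0 : 0 \in T by rewrite inE.
have TZ b v : v \in T -> b *: v \in T.
  rewrite !inE; case: (eqVneq b 0) => [->|b0]; first by rewrite scale0r.
  by rewrite fZ.
have cardT : #|T| = (wt c * (q - 1)).+1.
  rewrite (card_scaler_closed T0 TZ) (@card_points _ _ [set x | c x != 0]) // => x v _ xv.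
  by rewrite !inE (cf x v).
have [h [cF [E [ED Ebij]]]] := exists_prime_field_coordinates n.+1 hchar.
have h0 : (0 < h)%N by rewrite lt0n; apply: contraTneq q1 => h0; rewrite /q cF h0.
have qp : #|F|%:R = 0 :> 'F_p.
  by rewrite cF natrX pchar_Fp_0 ?expr0n ?eqn0Ngt ?h0.
have fT v : v \in T -> f v = f 0.
  rewrite inE => fv; case: (eqVneq v 0) => [->//|v0].
  apply: (@value_constant_on_support F _ n.+1 k f qp) => //.
    by move=> A rA; apply: (@sum_subspace_comb_rowg F p n hchar k a).
  rewrite -/T cardT -/q; move: wt_lt; move: (wt c) (q ^ k)%N => w Q wQ.
  by rewrite addSn addn1 ltnS -mulSnr leq_mul2r wQ orbT.
have Tle : (#|T| <= 2 * q ^ k.+1)%N.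
  rewrite cardT expnSr mulnA; move: wt_lt; move: (2 * q ^ k)%N (wt c) => Q w wQ.
  rewrite (leq_trans (_ : _ <= w * q + 1)%N) //; last by nia.
  by rewrite addn1 ltnS leq_mul2l leq_subr orbT.
have TD : {in T &, forall u v, u + v \in T}.
  have EinjP := bij_inj Ebij.
  suff ETD : {in E @: T &, forall u v, u + v \in E @: T}.
    by move=> u v uT vT; rewrite -(mem_imset T _ EinjP) ED ETD ?imset_f.
  have E0 : E 0 = 0 by apply: (addrI (E 0)); rewrite -ED !addr0.
  have EMn v j : E (v *+ j) = E v *+ j by elim: j => [|j IH]; rewrite ?mulr0n // !mulrS ED IH.
  (* This exponent makes [p ^ (k.+1 * h)] equal to [q ^ k.+1], matching [Tle]. *)
  apply: (@divisible_sections_add_closed _ _ (k.+1 * h)).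
  - by nia.
  - by rewrite card_Fp //; lia.
  - by nia.
  - by rewrite -E0 imset_f.
  - move=> b _ /imsetP[v vT ->]; rewrite -(natr_Zp b) scaler_nat -EMn imset_f //.
    by rewrite -scaler_nat TZ.
  - move=> W rW; rewrite card_Fp //.
    (* As f equals [f 0] on T, this sum is [f 0] times the size of the section, which p must
       therefore divide. *)
    have : \sum_(v in E @^-1: rowg W) f v = 0.
      exact: (sum_subspace_comb_prime_rowg hchar a cF ED Ebij rW).
    rewrite (bigID (mem T)) /= [X in _ + X]big1 ?addr0; last first.
      by move=> v /andP[_]; rewrite inE negbK => /eqP.
    rewrite (eq_bigr (fun=> f 0)) => [|v /andP[_ /fT//]].
    rewrite sumr_const -mulr_natr => /eqP; rewrite mulf_eq0 (negPf f0) /=.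
    rewrite -(dvdn_pcharf (pchar_Fp hp)).
    suff -> : #|E @: T :&: rowg W| = #|[predI E @^-1: rowg W & T]| by [].
    rewrite -(card_imset _ EinjP); apply: eq_card => y.
    have [v ->] : exists v, y = E v by case: (Ebij) => G _ GK; exists (G y); rewrite GK.
    by rewrite inE !(mem_imset _ _ EinjP) !inE andbC.
  by rewrite card_imset // card_Fp // (mulnC k.+1) expnM -cF.
have [A TA] := scaler_add_closed_rowg T0 TZ TD.
have cA : #|T| = (q ^ \rank A)%N by rewrite TA card_rowg.
(* The lower bound on the weight gives more than theta_k (q - 1) + 1 = q^(k+1) vectors in T. *)
have : (k.+1 < \rank A)%N.
  rewrite -(ltn_exp2l _ _ q1) -cA cardT.
  by move: wt_gt; rewrite /theta ltn_divLR ?subn_gt0 //; lia.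
(* The upper bound gives at most 2 q^(k+1) vectors, fewer than q^(k+2) because q is at least p >
   2. *)
rewrite leqNgt -(ltn_exp2l _ _ q1) -cA expnS => /negP; apply.
apply: leq_ltn_trans Tle _; rewrite ltn_pmul2r ?expn_gt0 ?(ltnW q1) //.
rewrite /q cF; apply: leq_trans (_ : p <= _)%N; first by lia.
by rewrite -{1}(expn1 p) leq_pexp2l // ltnW // prime_gt1.
Qed.
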